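(* Let $K$ be a field, let $n\ge 1$, and let $A\in\mathrm{M}_n(E^{(2)})$ be an $n\times n$ matrix over the two generated exterior algebra $$E^{(2)}=K\left\langle v_1,v_2\mid v_1v_2=-v_2v_1,\ v_1^2=v_2^2=0\right\rangle.$$ Then $A$ satisfies a Cayley-Hamilton identity of the form $$A^{2n}+c_{2n-1}A^{2n-1}+\cdots+c_1A+c_0I=0,$$ where $c_i\in K$ for $0\le i\le 2n-1$.
   Context: $E^{(2)}$ is the associative unital $K$-algebra with generators $v_1,v_2$ and the displayed relations; it has $K$-basis $1,v_1,v_2,v_1v_2$. $I$ denotes the $n\times n$ identity matrix. *)

(* Defs.v *)
From HB Require Import structures.
From mathcomp Require Import all_boot all_order all_algebra.
From mathcomp Require Import ring.

Set Implicit Arguments.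
Unset Strict Implicit.
Unset Printing Implicit Defensive.

Import GRing.Theory.
Local Open Scope ring_scope.

(* The algebra E^(2) = K< v1, v2 | v1 v2 = - v2 v1, v1^2 = v2^2 = 0 >, realized
   on the basis 1, v1, v2, v1 v2.  [ext2 a b c d] is a + b v1 + c v2 + d v1 v2.
   Theorem [ext2_presentation] shows that this is the algebra given by these
   generators and relations. *)
Record exterior2 (K : Type) := ext2 {
  ext2_one : K;
  ext2_v1 : K;
  ext2_v2 : K;
  ext2_v1v2 : K
}.

Section Exterior2.
Variable K : fieldType.
Local Notation E := (exterior2 K).
Implicit Types x y z : E.

Definition ext2_tuple x : K * K * K * K :=
  (ext2_one x, ext2_v1 x, ext2_v2 x, ext2_v1v2 x).
Definition tuple_ext2 (t : K * K * K * K) : E :=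
  let: (a, b, c, d) := t in ext2 a b c d.
Lemma ext2_tupleK : cancel ext2_tuple tuple_ext2. Proof. by case. Qed.

HB.instance Definition _ := Choice.copy E (can_type ext2_tupleK).

Definition ext2_add x y : E :=
  let: ext2 a b c d := x in let: ext2 a' b' c' d' := y in
  ext2 (a + a') (b + b') (c + c') (d + d').
Definition ext2_opp x : E :=
  let: ext2 a b c d := x in ext2 (- a) (- b) (- c) (- d).
Definition ext2_mul x y : E :=
  let: ext2 a b c d := x in let: ext2 a' b' c' d' := y in
  ext2 (a * a') (a * b' + b * a') (a * c' + c * a')
       (a * d' + b * c' - c * b' + d * a').
Definition ext2_scale (k : K) x : E :=
  let: ext2 a b c d := x in ext2 (k * a) (k * b) (k * c) (k * d).

Lemma ext2_addA : associative ext2_add.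
Proof. by move=> [????] [????] [????] /=; congr ext2; ring. Qed.
Lemma ext2_addC : commutative ext2_add.
Proof. by move=> [????] [????] /=; congr ext2; ring. Qed.
Lemma ext2_add0 : left_id (ext2 0 0 0 0) ext2_add.
Proof. by move=> [????] /=; congr ext2; ring. Qed.
Lemma ext2_addN : left_inverse (ext2 0 0 0 0) ext2_opp ext2_add.
Proof. by move=> [????] /=; congr ext2; ring. Qed.

HB.instance Definition _ :=
  GRing.isZmodule.Build E ext2_addA ext2_addC ext2_add0 ext2_addN.

Lemma ext2_mulA : associative ext2_mul.
Proof. by move=> [????] [????] [????] /=; congr ext2; ring. Qed.
Lemma ext2_mul1 : left_id (ext2 1 0 0 0) ext2_mul.
Proof. by move=> [????] /=; congr ext2; ring. Qed.
Lemma ext2_mulr1 : right_id (ext2 1 0 0 0) ext2_mul.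
Proof. by move=> [????] /=; congr ext2; ring. Qed.
Lemma ext2_mulDl : left_distributive ext2_mul +%R.
Proof. by move=> [????] [????] [????] /=; congr ext2; ring. Qed.
Lemma ext2_mulDr : right_distributive ext2_mul +%R.
Proof. by move=> [????] [????] [????] /=; congr ext2; ring. Qed.
Lemma ext2_1neq0 : ext2 1 0 0 0 != 0 :> E.
Proof. by apply/eqP => -[] /eqP; rewrite oner_eq0. Qed.

HB.instance Definition _ := GRing.Zmodule_isNzRing.Build E
  ext2_mulA ext2_mul1 ext2_mulr1 ext2_mulDl ext2_mulDr ext2_1neq0.

Lemma ext2_scaleA (k l : K) x :
  ext2_scale k (ext2_scale l x) = ext2_scale (k * l) x.
Proof. by case: x => ???? /=; congr ext2; ring. Qed.
Lemma ext2_scale1 : left_id 1 ext2_scale.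
Proof. by move=> [????] /=; congr ext2; ring. Qed.
Lemma ext2_scaleDr : right_distributive ext2_scale +%R.
Proof. by move=> k [????] [????] /=; congr ext2; ring. Qed.
Lemma ext2_scaleDl x : {morph ext2_scale^~ x : k l / k + l}.
Proof. by case: x => ???? k l /=; congr ext2; ring. Qed.

HB.instance Definition _ := GRing.Zmodule_isLmodule.Build K E
  ext2_scaleA ext2_scale1 ext2_scaleDr ext2_scaleDl.

Lemma ext2_scaleAl (k : K) x y : k *: (x * y) = (k *: x) * y.
Proof. by case: x y => [????] [????]; congr ext2; ring. Qed.
HB.instance Definition _ := GRing.Lmodule_isLalgebra.Build K E ext2_scaleAl.

Lemma ext2_scaleAr (k : K) x y : k *: (x * y) = x * (k *: y).
Proof. by case: x y => [????] [????]; congr ext2; ring. Qed.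
HB.instance Definition _ := GRing.Lalgebra_isAlgebra.Build K E ext2_scaleAr.

Definition v1 : E := ext2 0 1 0 0.
Definition v2 : E := ext2 0 0 1 0.

Lemma ext2_relations : [/\ v1 * v2 = - (v2 * v1), v1 ^+ 2 = 0 & v2 ^+ 2 = 0].
Proof. by split; rewrite ?expr2; congr ext2; ring. Qed.

Lemma ext2E (a b c d : K) :
  ext2 a b c d = a%:A + b *: v1 + c *: v2 + d *: (v1 * v2).
Proof. by congr ext2; ring. Qed.

Theorem ext2_presentation (B : algType K) (w1 w2 : B) :
    w1 * w2 = - (w2 * w1) -> w1 ^+ 2 = 0 -> w2 ^+ 2 = 0 ->
  exists2 f : {lrmorphism E -> B}, f v1 = w1 /\ f v2 = w2
    & forall g : {lrmorphism E -> B}, g v1 = w1 -> g v2 = w2 -> g =1 f.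
Proof.
move=> w12 w11 w22.
pose f x : B := ext2_one x *: 1 + ext2_v1 x *: w1 + ext2_v2 x *: w2
  + ext2_v1v2 x *: (w1 * w2).
have f_lin : linear f.
  move=> k [a b c d] [a' b' c' d']; rewrite /f /= !scalerDl !scalerDr !scalerA.
  by do 3 (rewrite [RHS]addrACA; congr (_ + _)).
have w21 : w2 * w1 = - (w1 * w2) by rewrite w12 opprK.
have w11' : w1 * w1 = 0 by rewrite -expr2.
have w22' : w2 * w2 = 0 by rewrite -expr2.
have w112 : w1 * (w1 * w2) = 0 by rewrite mulrA w11' mul0r.
have w212 : w2 * (w1 * w2) = 0 by rewrite mulrA w21 mulNr -mulrA w22' mulr0 oppr0.
have w121 : w1 * w2 * w1 = 0 by rewrite -mulrA w21 mulrN w112 oppr0.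
have w122 : w1 * w2 * w2 = 0 by rewrite -mulrA w22' mulr0.
have w1212 : w1 * w2 * (w1 * w2) = 0 by rewrite mulrA w121 mul0r.
have f_mon : monoid_morphism f.
  split=> [|[a b c d] [a' b' c' d']].
    by rewrite /f /= !scale0r !addr0 scale1r.
  rewrite /f /= !mulrDl !mulrDr -!scalerAl -!scalerAr !scalerA !mul1r !mulr1.
  rewrite w11' w22' w21 w112 w212 w121 w122 w1212 !scaler0 !addr0.
  rewrite !scalerDl !scalerN -!scaleNr.
  by rewrite [RHS](AC (4*2*2*1) ((1*(2*5))*(3*7)*(4*6*8*9))).
pose fL := GRing.isLinear.Build K E B *:%R f f_lin.
pose fM := GRing.isMonoidMorphism.Build E B f f_mon.
pose F : {lrmorphism E -> B} := HB.pack f fL fM.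
exists F => [|g gv1 gv2 [a b c d]].
  by split; rewrite /= /f /= !scale0r ?addr0 ?add0r scale1r.
by rewrite [in LHS]ext2E !linearD !linearZ /= rmorph1 rmorphM /= gv1 gv2.
Qed.
End Exterior2.
Arguments v1 {K}.
Arguments v2 {K}.

(* Main.v *)
Require Import Defs.
From HB Require Import structures.
From mathcomp Require Import all_boot all_order all_algebra.

Set Implicit Arguments.
Unset Strict Implicit.
Unset Printing Implicit Defensive.

Import GRing.Theory.
Local Open Scope ring_scope.

(** Write [A = A0 + A1 v1 + A2 v2 + A3 v1 v2] with the [Ai] over [K], and let
    [chi] be the characteristic polynomial of [A0].  The annihilating
    polynomial is [chi ^ 2].

    The component of [chi(A)] on [1] is [chi(A0) = 0], so only the components
    [D1] on [v1] and [D2] on [v2] survive in the square: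
    [chi(A)^2 = (D1 D2 - D2 D1) v1 v2].  It remains to see that [D1] and [D2]
    commute.  Each [Dj] is the derivative of [chi] at [A0] in the direction
    [Aj], that is the coefficient of [x] in [chi(A0 + x Aj)], because the
    components on [1] and [vj] multiply like polynomials in [x] modulo [x^2]
    ([leibniz_horner]).  The coefficient of [x] in the Cayley-Hamilton identity
    of [A0 + x Aj] over the commutative ring [K[x]] says that this derivative is
    compensated by the first-order variation of the characteristic polynomial,
    evaluated at [A0].  Thus [D1] and [D2] are both polynomials in the single
    matrix [A0] ([char_poly_direction_deriv]). *)

(** * First-order parts of matrix polynomials *)

(** With [sigma] a ring morphism, this says that [x |-> sigma x + e (d x)] is
    multiplicative for a central [e] with [e ^ 2 = 0]. *)
Definition leibniz {R S : pzRingType} (sigma d : R -> S) :=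
  forall x y, d (x * y) = sigma x * d y + d x * sigma y.

(** The coefficient of [e] in [(a + e x) ^ m], for a central [e] with
    [e ^ 2 = 0]. *)
Definition exp_deriv {S : pzRingType} (a x : S) (m : nat) : S :=
  \sum_(i < m) a ^+ i * x * a ^+ (m - i.+1).

Lemma exp_derivS (S : pzRingType) (a x : S) m :
  exp_deriv a x m.+1 = a * exp_deriv a x m + x * a ^+ m.
Proof.
rewrite /exp_deriv big_ord_recl expr0 mul1r subSS subn0 addrC; congr (_ + _).
by rewrite big_distrr /=; apply: eq_bigr => i _; rewrite exprS subSS !mulrA.
Qed.

Lemma leibniz_exp (R S : pzRingType) (sigma : {rmorphism R -> S})
    (d : {additive R -> S}) (a : R) m :
  leibniz sigma d -> d (a ^+ m) = exp_deriv (sigma a) (d a) m.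
Proof.
move=> dM; elim: m => [|m IHm]; last by rewrite exprS dM IHm rmorphXn exp_derivS.
have := dM 1 1; rewrite rmorph1 !mul1r mulr1 => /eqP.
by rewrite -subr_eq0 opprD addNKr oppr_eq0 expr0 /exp_deriv big_ord0 => /eqP.
Qed.

Lemma leibniz_map_mx (R S : nzRingType) (sigma : {rmorphism R -> S})
    (d : {additive R -> S}) n :
  leibniz sigma d ->
  leibniz (map_mx sigma : 'M_n.+1 -> 'M_n.+1) (map_mx d : 'M_n.+1 -> 'M_n.+1).
Proof.
move=> dM A B; apply/matrixP => i j; rewrite !mxE raddf_sum -big_split /=.
by apply: eq_bigr => k _; rewrite dM !mxE.
Qed.

(** The chain rule.  It is used twice: over [E^(2)] with scalar coefficients,
    where the second sum vanishes, and over [K[x]] with the coefficients of a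
    characteristic polynomial, where the left-hand side vanishes. *)
Lemma leibniz_horner (R S : nzRingType) (sigma : {rmorphism R -> S})
    (d : {additive R -> S}) n (A : 'M[R]_n.+1) (N : nat) (p : nat -> R) :
  leibniz sigma d ->
  map_mx d (\sum_(i < N) p i *: A ^+ i) =
    \sum_(i < N) sigma (p i) *: exp_deriv (map_mx sigma A) (map_mx d A) i
    + \sum_(i < N) d (p i) *: map_mx sigma A ^+ i.
Proof.
move=> dM; rewrite raddf_sum -big_split; apply: eq_bigr => i _ /=.
rewrite -(leibniz_exp _ _ (leibniz_map_mx (n := n) dM)) -rmorphXn /=.
by apply/matrixP => k l; rewrite !mxE dM.
Qed.

(** * The directional derivative of the characteristic polynomial *)

Lemma leibniz_coefp (K : comNzRingType) :
  leibniz (coefp 0 : {poly K} -> K) (coefp 1 : {poly K} -> K).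
Proof.
by move=> p q; rewrite /coefp /= coefM big_ord_recl big_ord1.
Qed.

Lemma sum_Cayley_Hamilton (K : comNzRingType) n (A : 'M[K]_n.+1) :
  \sum_(i < n.+2) (char_poly A)`_i *: A ^+ i = 0.
Proof.
apply: etrans (Cayley_Hamilton A); rewrite /horner_mx /= /horner_morph.
rewrite horner_coef size_map_poly_id0 ?size_char_poly; last first.
  by rewrite (monicP (char_poly_monic A)) rmorph1 oner_eq0.
by apply: eq_bigr => i _; rewrite coef_map /= -mulmxE mul_scalar_mx.
Qed.

(** The coefficient of [x] in the Cayley-Hamilton identity of [A + x X] is the
    derivative of [char_poly A] at [A] in the direction [X], plus the
    coefficient of [x] in [char_poly (A + x X)] evaluated at [A]. *)
Lemma char_poly_direction_deriv (K : comNzRingType) n (A X : 'M[K]_n.+1) :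
  exists q : {poly K},
    \sum_(i < n.+2) (char_poly A)`_i *: exp_deriv A X i = horner_mx A q.
Proof.
pose N : 'M[{poly K}]_n.+1 := map_mx polyC A + 'X *: map_mx polyC X.
have N0 : map_mx (coefp 0) N = A.
  by apply/matrixP=> i j; rewrite !mxE /= coefD coefC coefXM /= addr0.
have N1 : map_mx (coefp 1) N = X.
  by apply/matrixP=> i j; rewrite !mxE /= coefD coefC coefXM coefC /= add0r.
have chi0 i : ((char_poly N)`_i)`_0 = (char_poly A)`_i.
  by rewrite -[in RHS]N0 -map_char_poly coef_map.
have := leibniz_horner N n.+2 (fun i => (char_poly N)`_i)
  (@leibniz_coefp K).
rewrite sum_Cayley_Hamilton raddf0 N0 N1 => /esym/eqP; rewrite addr_eq0 => /eqP chiX.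
exists (- \poly_(i < n.+2) ((char_poly N)`_i)`_1).
rewrite rmorphN poly_def rmorph_sum /=.
transitivity (- \sum_(i < n.+2) ((char_poly N)`_i)`_1 *: A ^+ i).
  by rewrite -[RHS]chiX; apply: eq_bigr => i _; rewrite -chi0.
congr (- _); apply: eq_bigr => i _.
by rewrite linearZ /= rmorphXn /= horner_mx_X.
Qed.

(** * Components of matrices over the exterior algebra *)

Section Components.
Variable K : fieldType.
Local Notation E := (exterior2 K).

Lemma ext2_one_is_zmod_morphism : zmod_morphism (@ext2_one K).
Proof. by move=> [????] [????]. Qed.
HB.instance Definition _ :=
  GRing.isZmodMorphism.Build E K (@ext2_one K) ext2_one_is_zmod_morphism.

Lemma ext2_one_is_monoid_morphism : monoid_morphism (@ext2_one K).
Proof. by split=> [|[????] [????]]. Qed.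
HB.instance Definition _ :=
  GRing.isMonoidMorphism.Build E K (@ext2_one K) ext2_one_is_monoid_morphism.

Lemma ext2_v1_is_zmod_morphism : zmod_morphism (@ext2_v1 K).
Proof. by move=> [????] [????]. Qed.
HB.instance Definition _ :=
  GRing.isZmodMorphism.Build E K (@ext2_v1 K) ext2_v1_is_zmod_morphism.

Lemma ext2_v2_is_zmod_morphism : zmod_morphism (@ext2_v2 K).
Proof. by move=> [????] [????]. Qed.
HB.instance Definition _ :=
  GRing.isZmodMorphism.Build E K (@ext2_v2 K) ext2_v2_is_zmod_morphism.

Lemma leibniz_ext2_v1 : leibniz (@ext2_one K) (@ext2_v1 K).
Proof. by move=> [????] [????]. Qed.

Lemma leibniz_ext2_v2 : leibniz (@ext2_one K) (@ext2_v2 K).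
Proof. by move=> [????] [????]. Qed.

Lemma ext2_mul_one0 (x y : E) : ext2_one x = 0 -> ext2_one y = 0 ->
  x * y = ext2 0 0 0 (ext2_v1 x * ext2_v2 y - ext2_v2 x * ext2_v1 y).
Proof.
case: x y => [a b c d] [a' b' c' d'] /= -> ->.
by congr ext2; rewrite ?(mul0r, mulr0, addr0, add0r).
Qed.

(** The square is [(B1 B2 - B2 B1) v1 v2] because [v2 v1 = - v1 v2]. *)
Lemma sqr_mx_commuting_components n (B : 'M[E]_n.+1) :
    map_mx (@ext2_one K) B = 0 ->
    GRing.comm (map_mx (@ext2_v1 K) B) (map_mx (@ext2_v2 K) B) ->
  B * B = 0.
Proof.
move=> /matrixP B0 B12; apply/matrixP => i j.
have {}B0 k l : ext2_one (B k l) = 0 by have := B0 k l; rewrite !mxE.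
rewrite !mxE; under eq_bigr => k _ do rewrite ext2_mul_one0 //.
pose inj (c : K) : E := ext2 0 0 0 c.
have injD : {morph inj : c d / c + d}.
  by move=> c d; rewrite /inj; congr ext2; rewrite addr0.
rewrite -(big_morph inj injD (erefl (inj 0))) sumrB.
move/matrixP: B12 => /(_ i j); rewrite !mxE.
under eq_bigr => k _ do rewrite !mxE; move=> ->.
by under eq_bigr => k _ do rewrite !mxE; rewrite subrr.
Qed.

Definition scalar_horner_mx n (A : 'M[E]_n.+1) (p : {poly K}) : 'M[E]_n.+1 :=
  \sum_(i < size p) (p`_i)%:A *: A ^+ i.

(** Scalars from [K] are central in [E], so evaluation is multiplicative even
    though [A] has noncommuting entries. *)
Lemma scalar_horner_mxM n (A : 'M[E]_n.+1) :
  {morph scalar_horner_mx A : p q / p * q}.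
Proof.
pose f : {rmorphism K -> 'M[E]_n.+1} := @scalar_mx E n.+1 \o in_alg E.
have fA : commr_rmorph f A.
  move=> k; apply/matrixP => i j; rewrite /GRing.comm /f /= -mulmxE.
  rewrite mul_scalar_mx !mxE (bigD1 j) //= big1 ?addr0 => [|l lj].
    by rewrite mxE eqxx mulr1n -scalerAl -scalerAr mul1r mulr1.
  by rewrite mxE (negPf lj) mulr0.
have evalE p : scalar_horner_mx A p = horner_morph fA p.
  rewrite /horner_morph horner_coef size_map_poly; apply: eq_bigr => i _.
  by rewrite coef_map /= -mulmxE mul_scalar_mx.
by move=> p q; rewrite !evalE rmorphM.
Qed.

(** For [d] the component on [v1] or on [v2], the chain rule with constant
    coefficients turns the component of [chi(A)] into a directional derivative
    of [chi] at [A0]. *)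
Lemma component_char_poly (d : {additive E -> K}) n (A : 'M[E]_n.+1) :
    leibniz (@ext2_one K) d -> (forall k : K, d k%:A = 0) ->
  exists q : {poly K},
    map_mx d (scalar_horner_mx A (char_poly (map_mx (@ext2_one K) A)))
    = horner_mx (map_mx (@ext2_one K) A) q.
Proof.
move=> dM dK; set A0 := map_mx _ A.
have [q qE] := char_poly_direction_deriv A0 (map_mx d A).
exists q; rewrite -qE /scalar_horner_mx size_char_poly.
rewrite (leibniz_horner A n.+2 (fun i => ((char_poly A0)`_i)%:A) dM).
rewrite [X in _ + X]big1 ?addr0 => [|i _]; last by rewrite dK scale0r.
by apply: eq_bigr => i _; rewrite /= mulr1.
Qed.

End Components.

Theorem theorem2p1 (K : fieldType) (n : nat) (n_ge1 : (1 <= n)%N)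
    (A : 'M[exterior2 K]_n) :
  exists c : 'I_(2 * n) -> K,
    A ^+ (2 * n) + \sum_(i < 2 * n) (c i)%:A *: A ^+ i = 0.
Proof.
case: n n_ge1 A => // n _ A.
pose A0 := map_mx (@ext2_one K) A; pose chi := char_poly A0.
have chi_mon : chi \is monic := char_poly_monic A0.
have chi2_mon : chi * chi \is monic by rewrite monicMl.
have size_chi2 : size (chi * chi) = (2 * n.+1).+1.
  by rewrite size_monicM ?monic_neq0 // size_char_poly mul2n -addnn addnS.
have chi2A : scalar_horner_mx A (chi * chi) = 0.
  rewrite scalar_horner_mxM; apply: sqr_mx_commuting_components.
    rewrite raddf_sum /= size_char_poly -[RHS](sum_Cayley_Hamilton A0).
    apply: eq_bigr => i _; rewrite -rmorphXn.
    by apply/matrixP=> k l; rewrite !mxE rmorphM /= mulr1.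
  have [||q1 ->] := component_char_poly (d := @ext2_v1 K) A.
  - exact: leibniz_ext2_v1.
  - by move=> k; rewrite /= mulr0.
  have [||q2 ->] := component_char_poly (d := @ext2_v2 K) A.
  - exact: leibniz_ext2_v2.
  - by move=> k; rewrite /= mulr0.
  by rewrite /GRing.comm -!rmorphM mulrC.
(* The leading term of [chi ^ 2] is the isolated power [A ^+ (2 * n.+1)]. *)
exists (fun i => (chi * chi)`_i); rewrite -[RHS]chi2A /scalar_horner_mx size_chi2.
rewrite [RHS]big_ord_recr [RHS]addrC; congr (_ + _).
have := monicP chi2_mon; rewrite lead_coefE size_chi2 /= => ->.
by rewrite !scale1r.
Qed.
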